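(* Let $i\in I$ with $S^i(A,b)\neq\emptyset$, and let $\mathbf u=(u,u,\dots,u)\in[0,1]^n$ with $u=\frac{b_i-\sum_{j\in J}a_{ij}}{n}+1$. Then there is a $\mathbf y=(y,y,\dots,y)$ with $y\in[0,1]$ and $\mathbf y\le\mathbf u$ such that $\mathbf y$ is the unique optimal solution of the problem $$\text{minimize } Z(\mathbf y)=y\quad\text{subject to}\quad T_L(a_{i1},y)+T_L(a_{i2},y)+\cdots+T_L(a_{in},y)\ge b_i,\ y\in[0,1].$$
   Context: Let $I=\{1,\dots,m\}$, $J=\{1,\dots,n\}$, $A=(a_{ij})_{m\times n}$ with $a_{ij}\in[0,1]$, and $b=(b_1,\dots,b_m)$ with $b_i>0$ real. The Łukasiewicz t-norm is $T_L(a,x)=\max\{a+x-1,0\}$ on $[0,1]^2$. For $i\in I$, $S^i(A,b)=\{(y,y,\dots,y)\in[0,1]^n : \sum_{j\in J}T_L(a_{ij},y)\ge b_i\}$ is the feasible set of the problem. When $S^i(A,b)\ne\emptyset$, $u$ lies in $[0,1]$. Vectors are ordered componentwise. *)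

(* Defs.v *)
From mathcomp Require Import all_boot all_order all_algebra.
From mathcomp Require Import classical_sets reals.

Set Implicit Arguments.
Unset Strict Implicit.
Unset Printing Implicit Defensive.

Import Order.TTheory GRing.Theory Num.Theory.

Local Open Scope classical_set_scope.
Local Open Scope ring_scope.

(* The Lukasiewicz t-norm; it is only meaningful on [0, 1]^2. *)
Definition TL (R : realType) (a x : R) : R := Num.max (a + x - 1) 0.

Definition feasible_set (R : realType) (m n : nat) (A : 'M[R]_(m, n)) (b : 'rV[R]_m)
    (i : 'I_m) : set 'rV[R]_n :=
  [set (const_mx y : 'rV[R]_n) | y in
     [set y : R | 0 <= y <= 1 /\ \sum_(j < n) TL (A i j) y >= b 0 i]].

Definition vle (R : realType) (n : nat) (v w : 'rV[R]_n) : Prop :=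
  forall j : 'I_n, v 0 j <= w 0 j.

(* On a constant vector (y, ..., y) this is y; the first coordinate is read. *)
Definition Z (R : realType) (n : nat) (n_gt0 : (0 < n)%N) (v : 'rV[R]_n) : R :=
  v 0 (Ordinal n_gt0).

Definition optimal_solution (R : realType) (T : Type) (F : set T) (f : T -> R)
    (x : T) : Prop :=
  F x /\ forall w : T, F w -> f x <= f w.

Definition unique_optimal_solution (R : realType) (T : Type) (F : set T)
    (f : T -> R) (x : T) : Prop :=
  optimal_solution F f x /\ forall w : T, optimal_solution F f w -> w = x.

(* Main.v *)
(* The left-hand side of the constraint is n-Lipschitz in y, so the infimum of
   the feasible scalars is itself feasible. It is at most u because
   TL a u >= a + u - 1, and these lower bounds sum to exactly b_i. *)
Require Import Defs.
From mathcomp Require Import all_boot all_order all_algebra lra.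
From mathcomp Require Import classical_sets reals.

Import Order.TTheory GRing.Theory Num.Theory.

Local Open Scope classical_set_scope.
Local Open Scope ring_scope.

Lemma TL_ge_sub (R : realType) (a x : R) : a + x - 1 <= TL a x.
Proof. by rewrite /TL le_max lexx. Qed.

Lemma TL_le_left (R : realType) (a x : R) : 0 <= a -> x <= 1 -> TL a x <= a.
Proof. by move=> a_ge0 x_le1; rewrite /TL ge_max a_ge0 andbT; lra. Qed.

(** Each branch of the max grows by at most [y - x] when its argument moves from [x] up to [y]. *)
Lemma TL_lipschitz (R : realType) (a x y : R) :
  x <= y -> TL a y <= TL a x + (y - x).
Proof.
move=> le_xy; rewrite /TL ge_max.
have h1 : a + x - 1 <= Num.max (a + x - 1) 0 by rewrite le_max lexx.
have h2 : 0 <= Num.max (a + x - 1) 0 by rewrite le_max lexx orbT.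
by apply/andP; split; lra.
Qed.

Lemma sum_TL_lipschitz (R : realType) (n : nat) (a : 'I_n -> R) (x y : R) :
  x <= y ->
  \sum_(j < n) TL (a j) y <= \sum_(j < n) TL (a j) x + n%:R * (y - x).
Proof.
move=> le_xy.
have -> : n%:R * (y - x) = \sum_(j < n) (y - x).
  by rewrite sumr_const card_ord mulr_natl.
by rewrite -big_split; apply: ler_sum => j _; exact: TL_lipschitz.
Qed.

(** The infimum is attained: were the sum below [c] there, it would stay below [c] on a short
    interval to its right, yet members of [S] lie arbitrarily close. *)
Lemma sum_TL_min (R : realType) (n : nat) (n_gt0 : (0 < n)%N) (a : 'I_n -> R)
    (c : R) (S := [set y : R | 0 <= y <= 1 /\ c <= \sum_(j < n) TL (a j) y]) :
  S !=set0 -> exists2 y, S y & lbound S y.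
Proof.
move=> S0.
have S_inf : has_inf S by split=> //; exists 0 => y [/andP[]].
have inf_lb : lbound S (inf S) by apply: ge_inf; case: S_inf.
exists (inf S) => //; split.
  rewrite lb_le_inf //=; last by move=> y [/andP[]].
  by have [y Sy] := S0; apply: le_trans (inf_lb y Sy) _; case: Sy => /andP[].
rewrite leNgt; apply/negP => lt_c.
have nR_gt0 : 0 < n%:R :> R by rewrite ltr0n.
(* The shortfall at [inf S] divided by the Lipschitz constant [n]: a move of less than [d] cannot
   make it up. *)
set d := (c - \sum_(j < n) TL (a j) (inf S)) / n%:R.
have d_gt0 : 0 < d by rewrite divr_gt0 // subr_gt0.
have [z Sz lt_z] := inf_adherent d_gt0 S_inf.
have := sum_TL_lipschitz _ _ a _ _ (inf_lb z Sz).
have : n%:R * (z - inf S) < n%:R * d by rewrite ltr_pM2l // ltrBlDl.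
have -> : n%:R * d = c - \sum_(j < n) TL (a j) (inf S).
  by rewrite mulrC divfK // gt_eqF.
by case: Sz => _; lra.
Qed.

Theorem theorem5p5 (R : realType) (m n : nat) (n_gt0 : (0 < n)%N)
    (A : 'M[R]_(m, n)) (b : 'rV[R]_m)
    (A01 : forall (i : 'I_m) (j : 'I_n), 0 <= A i j <= 1)
    (b_gt0 : forall i : 'I_m, 0 < b 0 i)
    (i : 'I_m) (feasible_neq0 : feasible_set A b i !=set0)
    (u : R) (uE : u = (b 0 i - \sum_(j < n) A i j) / n%:R + 1) :
  exists y : R,
    [/\ 0 <= y <= 1,
        vle (const_mx y : 'rV[R]_n) (const_mx u) &
        unique_optimal_solution (feasible_set A b i) (Z n_gt0) (const_mx y)].
Proof.
have nR_gt0 : 0 < n%:R :> R by rewrite ltr0n.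
have [_ [y0 [/andP[_ y0_le1] y0_feas] _]] := feasible_neq0.
(* Any feasible point forces this bound, which is what gives [u <= 1]. *)
have b_le : b 0 i <= \sum_(j < n) A i j.
  apply: le_trans y0_feas _; apply: ler_sum => j _.
  by apply: TL_le_left => //; case/andP: (A01 i j).
(* Together with [b 0 i > 0], this gives [0 <= u]. *)
have sumA_le : \sum_(j < n) A i j <= n%:R.
  rewrite -[n in leRHS]card_ord -sumr_const; apply: ler_sum => j _.
  by case/andP: (A01 i j).
(* Since [u] is itself feasible, the least feasible scalar is at most [u]. *)
have Su : 0 <= u <= 1 /\ b 0 i <= \sum_(j < n) TL (A i j) u.
  split.
    have t_le0 : (b 0 i - \sum_(j < n) A i j) / n%:R <= 0.
      by rewrite ler_pdivrMr // mul0r subr_le0.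
    have t_geN1 : -1 <= (b 0 i - \sum_(j < n) A i j) / n%:R.
      by rewrite ler_pdivlMr // mulN1r; have := b_gt0 i; lra.
    by apply/andP; split; lra.
  have {1}-> : b 0 i = \sum_(j < n) (A i j + (u - 1)).
    rewrite big_split /= sumr_const card_ord -[_ *+ n]mulr_natr uE addrK.
    by rewrite divfK ?gt_eqF // addrC subrK.
  by apply: ler_sum => j _; rewrite addrA; exact: TL_ge_sub.
have [y Sy y_lb] := sum_TL_min _ _ n_gt0 (A i) (b 0 i) (ex_intro _ u Su).
have y_feas : feasible_set A b i (const_mx y) by exists y.
exists y; split.
- by case: Sy.
- by move=> j; rewrite !mxE; exact: y_lb.
- split.
    by split=> // _ [w Sw <-]; rewrite /Z !mxE; exact: y_lb.
  (* A constant vector is determined by its value under [Z], so two optimal ones coincide by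
     antisymmetry. *)
  move=> _ [[w Sw <-] /(_ _ y_feas)]; rewrite /Z !mxE => le_wy.
  by congr const_mx; apply: le_anti; rewrite le_wy; exact: y_lb.
Qed.
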